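(* Let $d\ge 2$ and $z\ge 1$ be integers. Let $v,u^{(1)},\dots,u^{(d)}$ be drawn independently from the Haar measure on $U(d)$, let $$U=S\cdot U^{[u],\mathrm L}\cdot(\mathbb 1_d\otimes v)$$ be the corresponding generic dual-unitary gate of the family $\mathcal S_{\mathrm L}$, and let $T^{\mathrm L}_z$ be the associated left transfer matrix acting on $(\mathbb C^d\otimes\mathbb C^d)^{\otimes z}$. Then, almost surely, $T^{\mathrm L}_z$ has a unique eigenvalue of maximal modulus, equal to $d$ (i.e. $d$ is a simple eigenvalue and every other eigenvalue has modulus strictly smaller than $d$), the corresponding right eigenvector is proportional to $|\circ\rangle^{\otimes z}$, and the corresponding left eigenvector is proportional to $\langle\circ|^{\otimes z}$.
   Context: $\{|j\rangle\}_{j=1}^d$ is the computational basis of $\mathbb C^d$. $S$ is the swap on $\mathbb C^d\otimes\mathbb C^d$: $S(|i\rangle\otimes|j\rangle)=|j\rangle\otimes|i\rangle$. For unitaries $u^{(1)},\dots,u^{(d)}\in U(d)$, the control gate $U^{[u],\mathrm L}$ is defined by $U^{[u],\mathrm L}(|i\rangle\otimes|j\rangle)=u^{(j)}|i\rangle\otimes|j\rangle$. The family $\mathcal S_{\mathrm L}$ is the set of all gates $S\cdot U^{[u],\mathrm L}\cdot(\mathbb 1_d\otimes v)$ with $v,u^{(1)},\dots,u^{(d)}\in U(d)$. A two-qudit gate $U$ acts on (left qudit)$\otimes$(right qudit), both for its inputs and for its outputs; the ''right-moving'' line enters on the left (first factor) and exits on the right (second factor), and the ''left-moving'' line enters on the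 right and exits on the left. Left transfer matrix: put $\hat U=S\,U$, so that $\hat U$ maps (right-mover in)$\otimes$(left-mover in) to (right-mover out)$\otimes$(left-mover out). On $\mathbb C^d_{(0)}\otimes(\mathbb C^d)^{\otimes z}$ (line qudit $0$ and qudits $1,\dots,z$) let $W=\hat U_{0,z}\cdots\hat U_{0,2}\hat U_{0,1}$, where $\hat U_{0,a}$ acts as $\hat U$ on qudits $0$ (first factor) and $a$ (second factor). $T_z^{\mathrm L}$ is the linear map on operators $X$ on $(\mathbb C^d)^{\otimes z}$ given by $$T_z^{\mathrm L}[X]=\mathrm{tr}_0\big[W(\mathbb 1_{(0)}\otimes X)W^\dagger\big],$$ regarded as a matrix on $(\mathbb C^d\otimes\mathbb C^d)^{\otimes z}$ through the vectorisation $\bigotimes_{a}|j_a\rangle\langle k_a|\mapsto\bigotimes_{a}|j_a\rangle\otimes|k_a\rangle$ (note the absence of any $1/d$ normalisation). $|\circ\rangle=\sum_{i=1}^d|i\rangle\otimes|i\rangle\in\mathbb C^d\otimes\mathbb C^d$ is the vectorised identity, and $\langle\circ|$ is its conjugate transpose. *)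

(* Defs.v *)
From mathcomp Require Import all_boot all_order all_algebra.
From mathcomp Require Import complex.
From mathcomp Require Import all_classical all_reals all_analysis.
Set Implicit Arguments.
Unset Strict Implicit.
Unset Printing Implicit Defensive.
Import Order.TTheory GRing.Theory Num.Theory.
Import numFieldNormedType.Exports.
Local Open Scope classical_set_scope.
Local Open Scope sesquilinear_scope.
Local Open Scope ring_scope.

(* A linear map C^J -> C^I between spaces whose computational bases are       *)
(* labelled by finite types I and J is a matrix of size #|I| x #|J| acting    *)
(* on column vectors, with labels and ordinals matched by enum_val/enum_rank. *)
(* Labels: 'I_d for a qudit, I * J for a tensor product, {ffun 'I_z -> I}     *)
(* for a z-fold tensor power.                                                 *)
Section LabelledMatrices.
Variable C : numClosedFieldType.
Implicit Types I J K L : finType.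

Definition fmx I J (F : I -> J -> C) : 'M[C]_(#|I|, #|J|) :=
  \matrix_(r, c) F (enum_val r) (enum_val c).

(* <i| A |j> *)
Definition entry I J (A : 'M[C]_(#|I|, #|J|)) (i : I) (j : J) : C :=
  A (enum_rank i) (enum_rank j).

Definition fcol I (f : I -> C) : 'cV[C]_#|I| := \col_r f (enum_val r).

Definition tens I J K L (A : 'M[C]_(#|I|, #|J|)) (B : 'M[C]_(#|K|, #|L|)) :
    'M[C]_(#|{: I * K}|, #|{: J * L}|) :=
  fmx (fun ik jl => entry A ik.1 jl.1 * entry B ik.2 jl.2).

Definition tens_pow I (z : nat) (psi : 'cV[C]_#|I|) :
    'cV[C]_#|{ffun 'I_z -> I}| :=
  fcol (fun r : {ffun 'I_z -> I} => \prod_a psi (enum_rank (r a)) 0).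

Definition ptrace1 I K (Y : 'M[C]_#|{: I * K}|) : 'M[C]_#|K| :=
  fmx (fun k l => \sum_(i : I) entry Y (i, k) (i, l)).

End LabelledMatrices.

Section Gates.
Variables (C : numClosedFieldType) (d : nat).

Definition swap_gate : 'M[C]_#|{: 'I_d * 'I_d}| :=
  fmx (fun o e : 'I_d * 'I_d => (o == (e.2, e.1))%:R).

(* |i> ⊗ |j> |-> u_j |i> ⊗ |j> *)
Definition ctrl_gateL (u : 'I_d -> 'M[C]_d) : 'M[C]_#|{: 'I_d * 'I_d}| :=
  fmx (fun o e : 'I_d * 'I_d => u e.2 o.1 e.1 * (o.2 == e.2)%:R).

Definition gate_SL (u : 'I_d -> 'M[C]_d) (v : 'M[C]_d) :
    'M[C]_#|{: 'I_d * 'I_d}| :=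
  swap_gate *m ctrl_gateL u *m tens 1%:M (fmx v).

Variable z : nat.

Definition qudits := {ffun 'I_z -> 'I_d}.
Definition qudit_pairs := {ffun 'I_z -> 'I_d * 'I_d}.

(* V acting on qudits 0 and a of C^d_(0) ⊗ (C^d)^{⊗z}, identity elsewhere; the *)
(* qudits 1, ..., z of the chain are numbered 0, ..., z - 1 here.              *)
Definition on_line (V : 'M[C]_#|{: 'I_d * 'I_d}|) (a : 'I_z) :
    'M[C]_#|{: 'I_d * qudits}| :=
  fmx (fun o e : 'I_d * qudits =>
    entry V (o.1, o.2 a) (e.1, e.2 a)
    * [forall b, (b != a) ==> (o.2 b == e.2 b)]%:R).

(* the factor of the first qudit is rightmost: it acts first *)
Definition lineW (U : 'M[C]_#|{: 'I_d * 'I_d}|) : 'M[C]_#|{: 'I_d * qudits}| :=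
  \big[mulmx/1%:M]_(a < z) on_line (swap_gate *m U) (rev_ord a).

Definition transferL_op (U : 'M[C]_#|{: 'I_d * 'I_d}|) (X : 'M[C]_#|qudits|) :
    'M[C]_#|qudits| :=
  ptrace1 (lineW U *m tens (1%:M : 'M[C]_#|'I_d|) X *m (lineW U) ^t*).

(* ⊗_a |j_a><k_a| |-> ⊗_a |j_a> ⊗ |k_a> *)
Definition vectorise (X : 'M[C]_#|qudits|) : 'cV[C]_#|qudit_pairs| :=
  fcol (fun r : qudit_pairs =>
    entry X [ffun a => (r a).1] [ffun a => (r a).2]).

(* ⊗_a |j_a><k_a| for the label c = (j_a, k_a)_a *)
Definition basis_op (c : qudit_pairs) : 'M[C]_#|qudits| :=
  delta_mx (enum_rank ([ffun a => (c a).1] : qudits))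
           (enum_rank ([ffun a => (c a).2] : qudits)).

Definition transferL (U : 'M[C]_#|{: 'I_d * 'I_d}|) : 'M[C]_#|qudit_pairs| :=
  \matrix_(r, c) vectorise (transferL_op U (basis_op (enum_val c))) r 0.

Definition ket_circ : 'cV[C]_#|{: 'I_d * 'I_d}| :=
  fcol (fun p : 'I_d * 'I_d => (p.1 == p.2)%:R).

End Gates.

Section Probability.
Variable R : realType.

(* The d x d complex matrices with their Borel sigma-algebra; R[i]^o carries  *)
(* the usual topology of the complex plane (the one of the modulus).          *)
Definition mxborel (d : nat) := g_sigma_algebraType (@open 'M[R[i]^o]_d).

(* The Haar probability measure of the compact group U(d), seen as a measure  *)
(* on all matrices that is carried by U(d): it is characterised by left       *)
(* invariance.                                                                *)
Definition is_haar (d : nat) (mu : set (mxborel d) -> \bar R) : Prop :=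
  mu [set g : 'M[R[i]]_d | g \is unitarymx] = 1%E /\
  forall (g : 'M[R[i]]_d) (A : set (mxborel d)),
    g \is unitarymx -> measurable A ->
    mu [set h : 'M[R[i]]_d | A (g *m h)] = mu A.

Definition mutually_independent d d' (T : measurableType d)
    (T' : measurableType d') (P : probability T R) (I : finType)
    (X : I -> {RV P >-> T'}) : Prop :=
  forall (J : {set I}) (A : I -> set T'), (forall i, measurable (A i)) ->
    P (\bigcap_(i in [set i | i \in J]) (X i @^-1` A i)) =
    (\prod_(i in J) P (X i @^-1` A i))%E.

End Probability.

(* Main.v *)
(* In the controlled gate the chain qudits only select which unitary acts on   *)
(* the line, so the transfer matrix factors as D.V: V = (v (x) v^bar)^{(x) z}  *)
(* is unitary and D is diagonal, with entry tr (u_o u_e^dagger) at |o><e|,     *)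
(* where u_o is the product of the controlled unitaries along the word o.      *)
(* Hence the spectral radius is at most d, and an extremal eigenvector is      *)
(* mapped by V into the span of the |o><e| with |tr (u_o u_e^dagger)| = d,     *)
(* i.e. u_o proportional to u_e.  If only o = e has this property, the         *)
(* eigenvector is a diagonal operator commuting up to a phase with v^{(x) z},  *)
(* hence a multiple of the identity when v has no zero entry.                  *)
(*   Both generic properties follow from left invariance of the Haar measure:  *)
(* translate the unitaries by matrices depending polynomially on a unimodular  *)
(* parameter s.  The bad event becomes the vanishing of a nonzero polynomial   *)
(* in s, so each sample lies in finitely many of the translated events; these  *)
(* all have the same probability, which must then be 0.                        *)

From HB Require Import structures.
Require Import Defs.
From mathcomp Require Import all_boot all_order all_algebra.
From mathcomp Require Import complex ring.
From mathcomp Require Import all_classical all_reals all_analysis.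
From mathcomp Require Import measurable_realfun.
Set Implicit Arguments.
Unset Strict Implicit.
Unset Printing Implicit Defensive.
Import Order.TTheory GRing.Theory Num.Theory.
Import numFieldNormedType.Exports.
Local Open Scope classical_set_scope.
Local Open Scope sesquilinear_scope.
Local Open Scope ring_scope.

(** * Spectral lemmas *)

(** Two deterministic facts and one probabilistic principle carry the proof. First,
    [extremal_eigenvector]: if distinct words of length [z] are never proportional and [v] has no
    zero entry, an eigenvector whose eigenvalue has modulus at least [d] is a diagonal operator, and
    comparing entries forces that operator to be scalar and the eigenvalue to be [d]. This settles
    the right eigenline. [left_eigenline] carries it to the left side, and [mup_simple_eigenvalue]
    turns it into algebraic simplicity, because the left and right eigenvectors pair to a nonzero
    number. Second, [word_nonproportional] reduces the condition on words to the nonvanishing of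
    countably many scalars [first_letter_minor], one for each pair of words with different first
    letters. The principle is [null_of_finitely_many]: equiprobable events such that almost every
    sample lies in only finitely many of them are null. [haar_entry_neq0_ae] applies it to the
    entries of a Haar unitary, [first_letter_minor_neq0_ae] to the minors; the latter uses the
    former and the independence of the controlled unitaries. *)

Section SimpleEigenvalue.
Variables (F : fieldType) (n : nat).
Implicit Types (T : 'M[F]_n) (u x : 'cV[F]_n) (w y : 'rV[F]_n) (l : F).

Lemma char_poly_trmx T : char_poly T^T = char_poly T.
Proof.
rewrite /char_poly -[RHS]det_tr /char_poly_mx linearB /= tr_scalar_mx.
by rewrite map_trmx.
Qed.

Lemma eigenvalue_col T l : eigenvalue T l ->
  exists2 x : 'cV[F]_n, x != 0 & T *m x = l *: x.
Proof.
rewrite eigenvalue_root_char -char_poly_trmx -eigenvalue_root_char.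
case/eigenvalueP => y yT y0; exists y^T; last first.
  by rewrite -[T in LHS]trmxK -trmx_mul yT linearZ.
by apply: contraNneq y0 => yT0; rewrite -[y]trmxK yT0 trmx0.
Qed.

(** The kernels of [T - l] and of its transpose have the same dimension. The right one is at most a
    line by hypothesis, and the left one contains the nonzero [w]. *)
Lemma left_eigenline T u w l : w != 0 -> w *m T = l *: w ->
  (forall x, T *m x = l *: x -> exists c, x = c *: u) ->
  forall y, y *m T = l *: y -> exists c, y = c *: w.
Proof.
move=> w0 wT line y yT; apply/sub_rVP.
apply: (@submx_trans _ _ _ _ _ _ (eigenspace T l)).
  exact/eigenspaceP.
have rank_le1 : (\rank (eigenspace T l) <= 1)%N.
  rewrite mxrank_ker -mxrank_tr -mxrank_ker.
  apply: leq_trans (rank_leq_row u^T); apply: mxrankS; apply/row_subP => i.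
  have /sub_kermxP : (row i (kermx (T - l%:M)^T) <= kermx (T - l%:M)^T)%MS.
    exact: row_sub.
  set r := row i _ => /(congr1 trmx); rewrite trmx_mul trmxK trmx0 mulmxBl.
  rewrite mul_scalar_mx => /eqP; rewrite subr_eq0 => /eqP /line[c rc].
  by apply/sub_rVP; exists c; rewrite -[LHS]trmxK rc linearZ.
have wE : (w <= eigenspace T l)%MS by exact/eigenspaceP.
by rewrite -(geq_leqif (mxrank_leqif_sup wE)) rank_rV w0.
Qed.

(** The matrix determinant lemma: the bordered matrix [M] has the characteristic polynomial as
    determinant, and a triangular multiplier of determinant ['X] clears its upper right block. The
    factor ['X] on the left avoids dividing. *)
Lemma char_poly_rank1 (a : F) u w :
  char_poly (a *: (u *m w)) * 'X = 'X^n * ('X - (a * (w *m u) 0 0)%:P).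
Proof.
pose U := map_mx polyC u; pose W := map_mx polyC w.
pose M := block_mx ('X%:M : 'M[{poly F}]_n) U
  (a%:P *: W) (1%:M : 'M[{poly F}]_1).
have -> : char_poly (a *: (u *m w)) = \det M.
  have -> : M = block_mx 1%:M U 0 1%:M *m
      block_mx (char_poly_mx (a *: (u *m w))) 0 (a%:P *: W) 1%:M.
    rewrite mulmx_block !mul1mx !mul0mx !mulmx1 !add0r /M.
    rewrite /char_poly_mx map_mxZ map_mxM -scalemxAr subrK.
    by [].
  by rewrite det_mulmx det_ublock det_lblock !det1 !mul1r mulr1.
have detX : \det (block_mx (1%:M : 'M[{poly F}]_n) (- U) 0
    ('X%:M : 'M[{poly F}]_1)) = 'X.
  by rewrite det_ublock det1 mul1r det_scalar1.
rewrite -[X in _ * X = _]detX -det_mulmx.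
rewrite mulmx_block !mulmx1 !mulmx0 !addr0 !mul1mx.
rewrite mulmxN mul_scalar_mx mul_mx_scalar addNr det_lblock det_scalar.
congr (_ * _); rewrite mulmxN -scalemxAl -map_mxM addrC det_mx11.
by rewrite !mxE mulr1n polyCM.
Qed.

(* Brauer's deflation: removing from [T] its part on the eigenline of [u]     *)
(* moves the eigenvalue [l] to [0] and leaves the rest of the spectrum alone. *)
Lemma mup_simple_eigenvalue T u w l : l != 0 ->
  T *m u = l *: u -> w *m T = l *: w -> (w *m u) 0 0 != 0 ->
  (forall y, y *m T = l *: y -> exists c, y = c *: w) ->
  mup l (char_poly T) = 1%N.
Proof.
move=> l0 Tu wT wu0 line; set b := (w *m u) 0 0 in wu0.
(* [P] is the projection onto the line of [u] along the kernel of [w]. *)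
pose P := b^-1 *: (u *m w); pose T' := T - l *: P.
have wuE : w *m u = b%:M by rewrite [LHS]mx11_scalar.
have Pu : P *m u = u.
  by rewrite -scalemxAl -mulmxA wuE mul_mx_scalar scalerA mulVf ?scale1r.
have TP : T *m P = l *: P.
  by rewrite -scalemxAr mulmxA Tu -scalemxAl scalerA mulrC -scalerA.
have PP : P *m P = P by rewrite {2}/P -scalemxAr mulmxA Pu.
have T'P : T' *m P = 0 by rewrite mulmxBl TP -scalemxAl PP subrr.
(* As [T' *m P = 0], the product of X - T' and X - l P has no constant term and equals X (X - T). *)
have factor : char_poly_mx T' *m char_poly_mx (l *: P) = 'X *: char_poly_mx T.
  rewrite /char_poly_mx mulmxBr mul_mx_scalar.
  rewrite mulmxBl mul_scalar_mx -map_mxM -scalemxAr T'P scaler0 map_mx0 subr0.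
  by rewrite -scalerBr /T' map_mxB opprB addrA addrAC addrK.
have := congr1 determinant factor; rewrite det_mulmx detZ.
rewrite -/(char_poly _) -/(char_poly T).
rewrite -/(char_poly T') => detE.
have rank1 := char_poly_rank1 (l / b) u w.
rewrite -/b divfK // -scalerA -/P in rank1.
have charE : char_poly T * 'X = char_poly T' * ('X - l%:P).
  apply: (@mulfI _ ('X^n)); first by rewrite monic_neq0 ?monicXn.
  by rewrite mulrA -detE -mulrA rank1 mulrCA.
have := congr1 (mup l) charE; rewrite mupMl ?rootE ?hornerX // => ->.
rewrite mupMr; first by rewrite -['X - _]expr1 mup_XsubCX eqxx.
(* It remains that [l] is not an eigenvalue of [T']. A left eigenvector for it would annihilate [u],
   hence be one for [T] and a multiple of [w], which pairs with [u] nontrivially. *)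
rewrite -eigenvalue_root_char; apply/eigenvalueP => -[y yT' y0].
have yu : (y *m u) 0 0 = 0.
  have : l *: (y *m u) = 0.
    rewrite scalemxAl -yT' -mulmxA mulmxBl Tu -scalemxAl Pu subrr mulmx0.
    by [].
  move/matrixP/(_ 0 0); rewrite !mxE => /eqP.
  by rewrite mulf_eq0 (negPf l0) => /eqP.
have yP : y *m P = 0.
  rewrite -scalemxAr mulmxA [y *m u]mx11_scalar yu mul_scalar_mx.
  by rewrite scale0r scaler0.
have [c yc] : exists c, y = c *: w.
  by apply: line; rewrite -yT' mulmxBr -scalemxAr yP scaler0 subr0.
move/eqP: yu; rewrite yc -scalemxAl mxE mulf_eq0 (negPf wu0) orbF => /eqP c0.
by rewrite yc c0 scale0r eqxx in y0.
Qed.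

End SimpleEigenvalue.

(** * Extremal eigenvectors of a diagonal matrix times a unitary *)

Section DiagonalTimesUnitary.
Variables (C : numClosedFieldType) (n : nat).

Lemma sum_norm_unitary (V : 'M[C]_n) (x : 'cV[C]_n) : V \is unitarymx ->
  \sum_r `|(V *m x) r 0| ^+ 2 = \sum_r `|x r 0| ^+ 2.
Proof.
move=> VU; have normE (y : 'cV[C]_n) : \sum_r `|y r 0| ^+ 2 = (y^t* *m y) 0 0.
  by rewrite mxE; apply: eq_bigr => r _; rewrite !mxE normCK mulrC.
rewrite !normE trmx_mul map_mxM -mulmxA [V^t* *m _]mulmxA.
by have /unitarymxP/mulmx1C -> := VU; rewrite mul1mx.
Qed.

(** Since [V] preserves the norm, the sum over k of (|l|^2 - |delta_k|^2) |(V x)_k|^2 vanishes. Its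
    terms are nonnegative, so each is zero. *)
Lemma extremal_eigenvector_support (V : 'M[C]_n) (delta : 'rV[C]_n)
    (K l : C) (x : 'cV[C]_n) : V \is unitarymx ->
  0 <= K <= `|l| -> (forall r, `|delta 0 r| <= K) ->
  diag_mx delta *m V *m x = l *: x ->
  forall r, `|delta 0 r| < K -> (V *m x) r 0 = 0.
Proof.
move=> VU /andP[K0 Kl] leK eigx r ltK.
have xr k : delta 0 k * (V *m x) k 0 = l * x k 0.
  by have /matrixP /(_ k 0) := eigx; rewrite -mulmxA mul_diag_mx !mxE.
have gap k : 0 <= (`|l| ^+ 2 - `|delta 0 k| ^+ 2) * `|(V *m x) k 0| ^+ 2.
  rewrite mulr_ge0 ?exprn_ge0 // subr_ge0 lerXn2r ?nnegrE //.
  exact: le_trans (leK k) Kl.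
have : \sum_k (`|l| ^+ 2 - `|delta 0 k| ^+ 2) * `|(V *m x) k 0| ^+ 2 = 0.
  under eq_bigr do rewrite mulrBl.
  rewrite sumrB -mulr_sumr sum_norm_unitary // mulr_sumr -sumrB big1 // => k _.
  by rewrite -!exprMn -!normrM xr subrr.
move=> /eqP; rewrite psumr_eq0 // => /allP /(_ r).
rewrite mem_index_enum => /(_ isT).
rewrite mulf_eq0 expf_eq0 normr_eq0 /= => /orP[|/eqP //].
rewrite subr_eq0 eqrXn2 // => /eqP lr.
by have := lt_le_trans ltK Kl; rewrite lr ltxx.
Qed.

End DiagonalTimesUnitary.

(** * Entries of the transfer matrix *)

Section LabelledEntries.
Variable C : numClosedFieldType.
Implicit Types I J K L : finType.

Lemma entry_fmx I J (F : I -> J -> C) i j : entry (fmx F) i j = F i j.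
Proof. by rewrite /entry mxE !enum_rankK. Qed.

Lemma fmx_entry I J (A : 'M[C]_(#|I|, #|J|)) : fmx (entry A) = A.
Proof. by apply/matrixP => i j; rewrite mxE /entry !enum_valK. Qed.

Lemma sum_ord_enum I (F : 'I_#|I| -> C) :
  \sum_r F r = \sum_(i : I) F (enum_rank i).
Proof.
rewrite (reindex (@enum_rank I)) //=.
by exists enum_val => j _; rewrite ?enum_rankK ?enum_valK.
Qed.

Lemma entry_mul I J K (A : 'M[C]_(#|I|, #|J|)) (B : 'M[C]_(#|J|, #|K|)) i k :
  entry (A *m B) i k = \sum_j entry A i j * entry B j k.
Proof. by rewrite /entry mxE sum_ord_enum. Qed.

Lemma entry1 I (i j : I) : entry (1%:M : 'M[C]_#|I|) i j = (i == j)%:R.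
Proof. by rewrite /entry mxE (inj_eq enum_rank_inj). Qed.

Lemma entry_adj I J (A : 'M[C]_(#|I|, #|J|)) i j :
  entry (A^t* : 'M[C]_(#|J|, #|I|)) j i = (entry A i j)^*.
Proof. by rewrite /entry !mxE. Qed.

Lemma sum_pair I J (F : I * J -> C) :
  \sum_p F p = \sum_i \sum_j F (i, j).
Proof. by rewrite pair_bigA; apply: eq_bigr => -[]. Qed.

End LabelledEntries.

Section Gate.
Variables (C : numClosedFieldType) (d z : nat).
Variables (u : 'I_d -> 'M[C]_d) (v : 'M[C]_d).
Let Uhat : 'M[C]_#|{: 'I_d * 'I_d}| := swap_gate C d *m gate_SL u v.
Implicit Types o : qudits d z.

(** The two swaps cancel: [v] acts on the chain qudit, and the label it produces selects the unitary
    applied to the line. *)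
Lemma entry_Uhat (o e : 'I_d * 'I_d) :
  entry Uhat o e = u o.2 o.1 e.1 * v o.2 e.2.
Proof.
rewrite /Uhat /gate_SL !mulmxA.
have -> : swap_gate C d *m swap_gate C d = 1%:M.
  rewrite -[LHS]fmx_entry -[RHS]fmx_entry; congr fmx; apply/funext => p.
  apply/funext => q; rewrite entry_mul entry1.
  under eq_bigr do rewrite !entry_fmx.
  rewrite (bigD1 (q.2, q.1)) //= eqxx mulr1 big1 ?addr0.
    by rewrite -surjective_pairing.
  by move=> j /negPf ->; rewrite mulr0.
rewrite mul1mx entry_mul.
under eq_bigr do rewrite /ctrl_gateL /tens !entry_fmx entry1.
rewrite (bigD1 (e.1, o.2)) //= !eqxx mulr1 mul1r big1 ?addr0 // => -[a b] /=.
rewrite xpair_eqE negb_and eq_sym => /orP[/negPf|/negPf]; last first.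
  by rewrite [_ == b]eq_sym => ->; rewrite mulr0 mul0r.
by move=> ->; rewrite mul0r mulr0.
Qed.

Definition word_at (s : seq 'I_z) o : 'M[C]_d :=
  \big[mulmx/1%:M]_(a <- s) u (o a).

Lemma entry_on_line_prod (s : seq 'I_z) (o0 e0 : 'I_d) o (e : qudits d z) :
    uniq s ->
  entry (\big[mulmx/1%:M]_(a <- s) on_line Uhat a) (o0, o) (e0, e) =
  word_at s o o0 e0 * \prod_(a <- s) v (o a) (e a) *
  [forall b, (b \notin s) ==> (o b == e b)]%:R.
Proof.
rewrite /word_at; elim: s o0 o => [|a s IHs] o0 o.
  move=> _; rewrite !big_nil entry1 !mxE mulr1 xpair_eqE -natrM mulnb.
  congr (_ && _)%:R; apply/eqP/forallP => [-> b|oe]; first exact/implyP.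
  by apply/ffunP => b; have /implyP/(_ isT)/eqP := oe b.
rewrite cons_uniq => /andP[a_s us]; rewrite !big_cons entry_mul.
(* The only intermediate label that contributes: the factor at [a] leaves the other sites alone, and
   the remaining factors leave [a] alone because [a] is not in [s]. *)
pose f := [ffun b => if b == a then e a else o b] : qudits d z.
have fE b : b != a -> f b = o b by rewrite ffunE => /negPf ->.
have fa : f a = e a by rewrite ffunE eqxx.
have s_ne b : b \in s -> b != a by move=> bs; apply: contraNneq a_s => <-.
transitivity (\sum_f0 u (o a) o0 f0 * v (o a) (e a) *
   ((\big[mulmx/1%:M]_(b <- s) u (f b)) f0 e0 *
    \prod_(b <- s) v (f b) (e b) *
    [forall b, (b \notin s) ==> (f b == e b)]%:R)).
  rewrite sum_pair.
  apply: eq_bigr => f0 _; rewrite (bigD1 f) //= [X in _ + X]big1 ?addr0.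
    rewrite entry_fmx IHs //= entry_Uhat /= fa.
    have -> : [forall b, (b != a) ==> (o b == f b)].
      by apply/forallP => b; apply/implyP => /fE ->.
    by rewrite mulr1.
  move=> f' f'f; rewrite entry_fmx IHs //.
  case: forallP => [of'|_]; last by rewrite mulr0 mul0r.
  case: forallP => [f'e|_]; last by rewrite !mulr0.
  case/eqP: f'f; apply/ffunP => b; rewrite ffunE; case: eqP => [->|/eqP ba].
    by have /implyP/(_ a_s)/eqP := f'e a.
  by have /implyP/(_ ba)/eqP := of' b.
have -> : \big[mulmx/1%:M]_(b <- s) u (f b) = \big[mulmx/1%:M]_(b <- s) u (o b).
  by apply: eq_big_seq => b /s_ne /fE ->.
have -> : \prod_(b <- s) v (f b) (e b) = \prod_(b <- s) v (o b) (e b).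
  by apply: eq_big_seq => b /s_ne /fE ->.
have -> : [forall b, (b \notin s) ==> (f b == e b)] =
          [forall b, (b \notin a :: s) ==> (o b == e b)].
  apply: eq_forallb => b; rewrite in_cons negb_or.
  by have [->|/fE ->] := eqVneq b a; first by rewrite fa eqxx implybT.
rewrite mxE !mulr_suml; apply: eq_bigr => f0 _.
by rewrite -!mulrA; congr (_ * _); rewrite mulrCA.
Qed.

Definition chain : seq 'I_z := [seq rev_ord a | a <- index_enum 'I_z].

Lemma entry_lineW (o0 e0 : 'I_d) o (e : qudits d z) :
  entry (lineW z (gate_SL u v)) (o0, o) (e0, e) =
  word_at chain o o0 e0 * \prod_a v (o a) (e a).
Proof.
have us : uniq chain.
  by rewrite map_inj_uniq ?index_enum_uniq //; exact: rev_ord_inj.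
have chainT b : b \in chain.
  by rewrite -[b]rev_ordK map_f ?mem_index_enum.
rewrite /lineW -(big_map (@rev_ord z) xpredT (on_line Uhat)).
rewrite entry_on_line_prod //.
have -> : [forall b, (b \notin chain) ==> (o b == e b)].
  by apply/forallP => b; rewrite chainT.
rewrite mulr1; congr (_ * _); rewrite big_map.
by rewrite [RHS](reindex_inj rev_ord_inj).
Qed.

(** The Hilbert-Schmidt product tr (u_o u_o'^dagger) of the two words. *)
Definition overlap o o' : C :=
  \sum_i \sum_e0 word_at chain o i e0 * (word_at chain o' i e0)^*.

Definition vpow o (e : qudits d z) : C := \prod_a v (o a) (e a).

Definition ket_part (c : qudit_pairs d z) : qudits d z := [ffun a => (c a).1].
Definition bra_part (c : qudit_pairs d z) : qudits d z := [ffun a => (c a).2].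

(** The [v] factors in [lineW] do not depend on the line labels, so tracing out the line contracts
    only the word matrices. *)
Lemma transferL_entry (r c : qudit_pairs d z) :
  entry (transferL z (gate_SL u v)) r c =
  overlap (ket_part r) (bra_part r) *
  (vpow (ket_part r) (ket_part c) * (vpow (bra_part r) (bra_part c))^*).
Proof.
rewrite /entry !mxE !enum_rankK /transferL_op /ptrace1 entry_fmx.
rewrite -/(ket_part r) -/(bra_part r) /overlap mulr_suml.
apply: eq_bigr => i _; rewrite -mulmxA entry_mul mulr_suml.
rewrite sum_pair.
apply: eq_bigr => e0 _.
transitivity (\sum_e \sum_e' (e == ket_part c)%:R * (e' == bra_part c)%:R *
   (entry (lineW z (gate_SL u v)) (i, ket_part r) (e0, e) *
   (entry (lineW z (gate_SL u v)) (i, bra_part r) (e0, e'))^*)).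
  apply: eq_bigr => e _; rewrite entry_mul.
  rewrite sum_pair.
  rewrite (bigD1 e0) //= [X in _ + X]big1 ?addr0 => [|e1 e1e0]; last first.
    rewrite big1 // => e' _; rewrite entry_fmx /= entry1 eq_sym (negPf e1e0).
    by rewrite !mul0r.
  rewrite mulr_sumr; apply: eq_bigr => e' _.
  rewrite entry_fmx /= entry1 eqxx mul1r entry_adj.
  rewrite /basis_op /entry mxE !(inj_eq enum_rank_inj) -!/(entry _ _ _).
  by rewrite -mulnb natrM mulrCA.
rewrite (bigD1 (ket_part c)) //=.
rewrite [X in _ + X]big1 ?addr0 => [|e /negPf ne]; last first.
  by rewrite big1 // => e' _; rewrite ne !mul0r.
rewrite (bigD1 (bra_part c)) //=.
rewrite [X in _ + X]big1 ?addr0 => [|e /negPf ne]; last first.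
  by rewrite ne mulr0 !mul0r.
rewrite !eqxx !mul1r !entry_lineW rmorphM /=.
by rewrite /vpow; ring.
Qed.

End Gate.

(** * Translates by unitaries polynomial in a unimodular parameter *)

Section UnitCirclePolynomials.
Variable C : numClosedFieldType.

(** The Cayley transforms (1 + n i) / (1 - n i) of the natural numbers. *)
Lemma injective_unimodular :
  exists2 s : nat -> C, injective s & forall n, s n * (s n)^* = 1.
Proof.
pose q (n : nat) : C := 1 - n%:R * 'i.
have Jq n : (q n)^* = 1 + n%:R * 'i.
  by rewrite /q rmorphB rmorph1 rmorphM /= conjCi conjC_nat mulrN opprK.
have q0 n : q n != 0.
  apply/eqP => qn0; have : q n + (q n)^* = 2 by rewrite Jq /q; ring.
  by rewrite qn0 conjC0 addr0 => /esym/eqP; rewrite pnatr_eq0.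
exists (fun n => (q n)^* / q n) => [m n /eqP|n].
  rewrite eqr_div // !Jq /q => /eqP eqmn.
  have : (m%:R - n%:R) * (2 * 'i) = 0 :> C.
    by move: eqmn => /eqP; rewrite -subr_eq0 => /eqP e; rewrite -[RHS]e; ring.
  move=> /eqP; rewrite mulf_eq0 mulf_eq0 (negPf (neq0Ci _)) pnatr_eq0 !orbF.
  by rewrite subr_eq0 eqr_nat => /eqP.
rewrite rmorphM /= fmorphV /= conjCK.
by field; rewrite q0 conjC_eq0 q0.
Qed.

Lemma eventually_not_root (p : {poly C}) (s : nat -> C) : p != 0 ->
  injective s -> exists n0, forall n, (n0 <= n)%N -> p.[s n] != 0.
Proof.
move=> p0 s_inj; have [r pE] := closed_field_poly_normal p.
suff [n0 nr] : exists n0, forall n, (n0 <= n)%N -> s n \notin r.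
  exists n0 => n /nr; rewrite pE hornerZ mulf_eq0 lead_coef_eq0 (negPf p0) /=.
  by rewrite -/(root _ _) root_prod_XsubC.
elim: r {p p0 pE} => [|c r [n0 nr]]; first by exists 0%N.
have [[m sm]|c_s] := pselect (exists m, s m = c).
  exists (maxn n0 m.+1) => n; rewrite geq_max => /andP[/nr sn mn].
  rewrite in_cons negb_or sn andbT -sm (inj_eq s_inj).
  by apply: contraTneq mn => ->; rewrite ltnn.
exists n0 => n /nr sn; rewrite in_cons negb_or sn andbT.
by apply/eqP => snc; apply: c_s; exists n.
Qed.

End UnitCirclePolynomials.

Section Translates.
Variables (C : numClosedFieldType) (d : nat).
Implicit Types (h : 'M[C]_d) (s : C) (i j k x y : 'I_d) (t : seq 'I_d).

Lemma diag_unitary (D : 'rV[C]_d) : (forall k, D 0 k * (D 0 k)^* = 1) ->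
  diag_mx D \is unitarymx.
Proof.
move=> D1; apply/unitarymxP; rewrite tr_diag_mx map_diag_mx mulmx_diag.
apply/matrixP => i j; rewrite !mxE; congr (_ *+ _); exact: D1.
Qed.

(* [1 - a J], with [J] the all-ones matrix, is unitary as soon as             *)
(* [a + a^* = d |a|^2]; the imaginary part of [a] keeps its entries nonzero.  *)
Definition dense_unitary : 'M[C]_d := 1%:M - const_mx ((1 - 'i) / d%:R).

Lemma dense_unitaryP : dense_unitary \is unitarymx.
Proof.
have [d0|d0] := posnP d.
  by apply/unitarymxP/matrixP => i; have := ltn_ord i; rewrite {2}d0.
have dC0 : d%:R != 0 :> C by rewrite pnatr_eq0 -lt0n.
set a := (1 - 'i) / d%:R : C.
have Ja : a^* = (1 + 'i) / d%:R.
  by rewrite /a rmorphM /= fmorphV rmorph_nat rmorphB /= rmorph1 conjCi opprK.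
apply/unitarymxP; rewrite /dense_unitary -/a.
rewrite linearB /= trmx1 trmx_const map_mxB map_mx1 map_const_mx /=.
rewrite mulmxBl mul1mx mulmxBr mulmx1.
suff -> : const_mx a *m (const_mx a^* : 'M[C]_d) =
    const_mx a^* + const_mx a :> 'M[C]_d.
  by rewrite opprB addrK subrK.
apply/matrixP => i j; rewrite !mxE.
under eq_bigr do rewrite !mxE.
rewrite sumr_const card_ord -mulr_natr Ja /a.
have i2 : 'i * 'i = -1 :> C by rewrite -expr2 sqrCi.
apply: (mulIf dC0); rewrite -!mulrA; move: i2 dC0; set I := 'i => i2 dC0.
have -> : (1 - I) * (d%:R^-1 * ((1 + I) * (d%:R^-1 * (d%:R * d%:R)))) =
   (1 - I * I) by field.
by rewrite i2; field.
Qed.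

Lemma dense_unitary_neq0 i j : dense_unitary i j != 0.
Proof.
have d0 : (0 < d)%N by apply: leq_ltn_trans (ltn_ord i).
have dC0 : d%:R != 0 :> C by rewrite pnatr_eq0 -lt0n.
have dR : (d%:R^-1 : C) \is Num.real by rewrite realV realn.
rewrite !mxE; apply/eqP => /(congr1 (fun c : C => 'Im c)).
have -> : (i == j)%:R - (1 - 'i) / d%:R =
    ((i == j)%:R - d%:R^-1) + 'i * d%:R^-1 :> C by field.
rewrite Im_rect ?rpredB ?realn ?rpred0//.
by move=> /eqP; rewrite raddf0 invr_eq0 (negPf dC0).
Qed.

(** The diagonal factor multiplies row k of a matrix by [s ^+ k], so distinct rows enter distinct
    coefficients; the dense factor then mixes all rows into each entry with nonzero weights. *)
Definition entry_mover s : 'M[C]_d :=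
  dense_unitary *m diag_mx (\row_k s ^+ k).

Lemma entry_mover_unitary s : s * s^* = 1 -> entry_mover s \is unitarymx.
Proof.
move=> s1; apply: mul_unitarymx; first exact: dense_unitaryP.
by apply: diag_unitary => k; rewrite !mxE rmorphXn /= -exprMn s1 expr1n.
Qed.

Lemma entry_mover_poly h i j : h \is unitarymx ->
  exists2 p : {poly C}, p != 0 & forall s, (entry_mover s *m h) i j = p.[s].
Proof.
move=> hU; have d0 : (0 < d)%N by apply: leq_ltn_trans (ltn_ord i).
have [k hk] : exists k, h k j != 0.
  apply/existsP; rewrite -negb_forall; apply/negP => /forallP col0.
  have := unitarymx_unit hU => /mulmxV; move/mulmx1C => /matrixP /(_ j j).
  rewrite !mxE eqxx big1 => [/eqP|k _]; first by rewrite eq_sym oner_eq0.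
  by have := col0 k => /eqP ->; rewrite mulr0.
exists (\sum_k (dense_unitary i k * h k j)%:P * 'X^k) => [|s].
  apply/eqP => /(congr1 (fun q : {poly C} => q`_k)).
  rewrite coef0 coef_sum (bigD1 k) //= big1 => [|l lk]; last first.
    by rewrite coefCM coefXn eq_sym (inj_eq val_inj) (negPf lk) mulr0.
  rewrite addr0 coefCM coefXn eqxx mulr1 => /eqP.
  by rewrite mulf_eq0 (negPf (dense_unitary_neq0 _ _)) (negPf hk).
rewrite horner_sum mxE; apply: eq_bigr => k' _.
by rewrite /entry_mover mul_mx_diag !mxE hornerCM hornerXn mulrAC.
Qed.

Fixpoint word (u : 'I_d -> 'M[C]_d) t : 'M[C]_d :=
  if t is x :: t' then u x *m word u t' else 1%:M.

(** Each letter has its own marked row: translating [h x] multiplies by [s] only the row [x]. *)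
Definition letter_mover x s : 'M[C]_d :=
  diag_mx (\row_k if k == x then s else 1).

Lemma letter_mover_unitary x s : s * s^* = 1 -> letter_mover x s \is unitarymx.
Proof.
move=> s1; apply: diag_unitary => k; rewrite !mxE; case: eqP => // _.
by rewrite rmorph1 mulr1.
Qed.

(** The 2 by 2 minor on rows [x] and [y] formed by the columns [x] of the two words. It vanishes if
    the words are proportional; rows [x] and [y] are those marked by the two first letters. *)
Definition first_letter_minor (u : 'I_d -> 'M[C]_d) x y t t' : C :=
  word u (x :: t) x x * word u (y :: t') y x -
  word u (x :: t) y x * word u (y :: t') x x.

(** * Words of translated letters as polynomials in the parameter *)

Section PolynomialWord.
Variable h : 'I_d -> 'M[C]_d.
Hypothesis h_neq0 : forall x i j, h x i j != 0.

Fixpoint pword t : 'M[{poly C}]_d :=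
  if t is x :: t' then
    diag_mx (\row_k if k == x then 'X else 1) *m
      (map_mx polyC (h x) *m pword t')
  else 1%:M.

Lemma pword_cons x t i j : pword (x :: t) i j =
  (if i == x then 'X else 1) * \sum_k (h x i k)%:P * pword t k j.
Proof.
rewrite /= mul_diag_mx !mxE; congr (_ * _).
by apply: eq_bigr => k _; rewrite mxE.
Qed.

Lemma pword_nil i j : pword [::] i j = (i == j)%:R.
Proof. by rewrite mxE. Qed.

Arguments pword : simpl never.

Lemma horner_pword t i j s :
  (pword t i j).[s] = word (fun x => letter_mover x s *m h x) t i j.
Proof.
elim: t i j => [|x t IHt] i j.
  by rewrite pword_nil mxE; case: eqP => _; rewrite ?hornerC ?horner0.
rewrite pword_cons /= -mulmxA mul_diag_mx !mxE hornerM horner_sum.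
congr (_ * _); first by case: ifP; rewrite hornerE.
by apply: eq_bigr => k _; rewrite hornerM hornerC IHt.
Qed.

Lemma size_pword t i j : (size (pword t i j) <= (size t).+1)%N.
Proof.
elim: t i j => [|x t IHt] i j.
  by rewrite pword_nil; case: eqP; rewrite ?size_poly1 ?size_poly0.
rewrite pword_cons; set S := \sum_k _.
have sS : (size S <= (size t).+1)%N.
  apply: leq_trans (size_sum _ _ _) _; apply/bigmax_leqP => k _.
  rewrite mul_polyC.
  exact: leq_trans (size_scale_leq _ _) (IHt _ _).
case: ifP => _; last by rewrite mul1r (leq_trans sS).
by apply: leq_trans (size_polyMleq _ _) _; rewrite size_polyX.
Qed.

Lemma size_pword_neq x t i j : i != x ->
  (size (pword (x :: t) i j) <= (size t).+1)%N.
Proof.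
move=> /negPf ix; rewrite pword_cons ix mul1r.
apply: leq_trans (size_sum _ _ _) _; apply/bigmax_leqP => k _.
by rewrite mul_polyC (leq_trans (size_scale_leq _ _)) ?size_pword.
Qed.

(* Only the path through the diagonal entries carrying [s] reaches top degree. *)
Lemma coef_pword x t j : (pword (x :: t) x j)`_(size t).+1 != 0.
Proof.
elim: t x j => [|y t IHt] x j; rewrite pword_cons eqxx coefXM /= coef_sum.
  rewrite (bigD1 j) //= big1 => [|k kj]; last first.
    by rewrite pword_nil (negPf kj) mulr0 coef0.
  rewrite pword_nil eqxx mulr1 addr0 coefC; exact: h_neq0.
rewrite (bigD1 y) //= big1 => [|k ky].
  by rewrite addr0 coefCM mulf_neq0.
by rewrite coefCM [_`__]nth_default ?mulr0 // size_pword_neq.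
Qed.

(** In the first product both words start in their marked row, so each reaches full degree. In the
    second both start off it and each loses a degree, so the top coefficient of the first product
    survives. *)
Lemma first_letter_minor_poly x y t t' : x != y ->
  exists2 p : {poly C}, p != 0 & forall s,
    first_letter_minor (fun a => letter_mover a s *m h a) x y t t' = p.[s].
Proof.
move=> xy; exists (pword (x :: t) x x * pword (y :: t') y x -
  pword (x :: t) y x * pword (y :: t') x x) => [|s]; last first.
  by rewrite hornerD hornerN !hornerM !horner_pword.
apply/eqP => /(congr1 (fun q : {poly C} => q`_((size t).+1 + (size t').+1))).
rewrite coef0 coefB [X in _ - X]nth_default ?subr0; last first.
  apply: leq_trans (size_polyMleq _ _) _.
  apply: leq_trans (leq_pred _) (leq_add _ _); apply: size_pword_neq => //.
  by rewrite eq_sym.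
have top (p q : {poly C}) m n : (size p <= m.+1)%N -> (size q <= n.+1)%N ->
    (p * q)`_(m + n) = p`_m * q`_n.
  move=> pm qn; rewrite coefM (bigD1 (inord m)) //= inordK ?ltnS ?leq_addr //.
  rewrite addKn big1 ?addr0 // => k.
  rewrite -(inj_eq val_inj) /= inordK ?ltnS ?leq_addr //.
  case: ltngtP => // [km|mk] _.
    by rewrite [X in _ * X]nth_default ?mulr0 // (leq_trans qn) //
      ltn_subRL ltn_add2r.
  by rewrite [X in X * _]nth_default ?mul0r // (leq_trans pm).
rewrite top ?size_pword // => /eqP.
by rewrite mulf_eq0 (negPf (coef_pword _ _ _)) (negPf (coef_pword _ _ _)).
Qed.

End PolynomialWord.

(** A common first letter is unitary and cancels; at the first difference, proportionality would
    make the minor vanish. *)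
Lemma word_nonproportional (u : 'I_d -> 'M[C]_d) t t' (c : C) :
  (forall x, u x \is unitarymx) ->
  (forall x y r r', x != y -> first_letter_minor u x y r r' != 0) ->
  size t = size t' -> t != t' -> word u t != c *: word u t'.
Proof.
move=> uU minor0; elim: t t' => [|x t IHt] [|y t'] //= [st].
have [->|xy _] := eqVneq x y.
  rewrite eqseq_cons eqxx /= => tt'; apply: contraNneq (IHt _ st tt').
  rewrite scalemxAr => /(congr1 (mulmx (invmx (u y)))).
  by rewrite !mulKmx ?unitarymx_unit // => ->.
have := minor0 x y t t' xy; apply: contraNneq => E.
by rewrite /first_letter_minor /= E !mxE; apply/eqP; ring.
Qed.

End Translates.

(** * Spectrum of the transfer matrix of a generic gate *)

Section Overlap.
Variables (C : numClosedFieldType) (d : nat).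
Implicit Types A B : 'M[C]_d.

Lemma sum_norm_unitarymx A : A \is unitarymx ->
  \sum_i \sum_k A i k * (A i k)^* = d%:R.
Proof.
move=> /unitarymxP AU; rewrite -[RHS]mulr1n -[in RHS](card_ord d).
rewrite mulrnAC -sumr_const.
apply: eq_bigr => i _; have /matrixP /(_ i i) := AU; rewrite !mxE eqxx => <-.
by apply: eq_bigr => k _; rewrite !mxE.
Qed.

(* [d - |D|^2 / d] is the squared Hilbert-Schmidt distance from [A] to the    *)
(* line of [B], where [D] is the overlap.                                     *)
Lemma overlap_unitary_lt A B : A \is unitarymx -> B \is unitarymx ->
  (forall c, A != c *: B) -> `|\sum_i \sum_k A i k * (B i k)^*| < d%:R.
Proof.
move=> AU BU nprop; set D := \sum_i _.
have d0 : (0 < d)%N.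
  rewrite lt0n; apply/negP => /eqP d0; have /eqP := nprop 0; apply.
  by apply/matrixP => i; have := ltn_ord i; rewrite {2}d0.
have dC : 0 < d%:R :> C by rewrite ltr0n.
pose c := D / d%:R.
have distE : \sum_i \sum_k `|A i k - c * B i k| ^+ 2 = d%:R - `|D| ^+ 2 / d%:R.
  transitivity (\sum_i \sum_k A i k * (A i k)^* - c^* * D - c * D^* +
     c * c^* * (\sum_i \sum_k B i k * (B i k)^*)).
    rewrite /D rmorph_sum /= !mulr_sumr -!sumrB -big_split.
    apply: eq_bigr => i _.
    rewrite rmorph_sum /= !mulr_sumr -!sumrB -big_split; apply: eq_bigr => k _.
    by rewrite normCK !(rmorphB, rmorphM) /= conjCK; ring.
  rewrite !sum_norm_unitarymx // normCK /c rmorphM /= fmorphV rmorph_nat.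
  by field; rewrite gt_eqF.
have [lt|ge] := boolP (`|D| < d%:R) => //; exfalso.
have : \sum_i \sum_k `|A i k - c * B i k| ^+ 2 == 0.
  rewrite eq_le; apply/andP; split; last first.
    by apply: sumr_ge0 => i _; apply: sumr_ge0 => k _; rewrite exprn_ge0.
  rewrite distE subr_le0 ler_pdivlMr // -expr2 lerXn2r ?nnegrE //.
  by rewrite real_leNgt ?realE ?normr_ge0 ?ler0n.
rewrite psumr_eq0 => [/allP row0|i _]; last first.
  by apply: sumr_ge0 => k _; rewrite exprn_ge0.
have /eqP := nprop c; apply; apply/matrixP => i k; rewrite mxE.
have := row0 i (mem_index_enum _).
rewrite psumr_eq0 => [/allP|k' _]; last first.
  by rewrite exprn_ge0.
move=> /(_ k (mem_index_enum _)).
by rewrite expf_eq0 normr_eq0 subr_eq0 => /eqP.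
Qed.

End Overlap.

(** * Eigenvectors of the transfer matrix under the generic conditions *)

Section TransferSpectrum.
Variables (C : numClosedFieldType) (d z : nat).
Variables (u : 'I_d -> 'M[C]_d) (v : 'M[C]_d).
Hypothesis d_gt0 : (0 < d)%N.
Hypothesis u_unitary : forall a, u a \is unitarymx.
Hypothesis v_unitary : v \is unitarymx.
Hypothesis v_neq0 : forall i j, v i j != 0.
Hypothesis minor_neq0 :
  forall x y t t', x != y -> first_letter_minor u x y t t' != 0.
Let T := transferL z (gate_SL u v).
Let circ : 'cV[C]_#|qudit_pairs d z| := tens_pow z (ket_circ C d).
Implicit Types o e : qudits d z.

Lemma word_atE (s : seq 'I_z) o : word_at u s o = word u [seq o a | a <- s].
Proof.
by rewrite /word_at; elim: s => [|a s IHs] /=; rewrite (big_nil, big_cons) ?IHs.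
Qed.

Lemma word_unitary (t : seq 'I_d) : word u t \is unitarymx.
Proof.
elim: t => [|x t IHt] /=; last exact: mul_unitarymx.
by apply/unitarymxP; rewrite trmx1 map_mx1 mulmx1.
Qed.

Lemma overlap_diag o : overlap u o o = d%:R.
Proof. by rewrite /overlap sum_norm_unitarymx // word_atE word_unitary. Qed.

Lemma overlap_lt o e : o != e -> `|overlap u o e| < d%:R.
Proof.
move=> oe; apply: overlap_unitary_lt; rewrite ?word_atE ?word_unitary // => c.
apply: word_nonproportional; rewrite ?size_map //.
apply: contraNneq oe => /eq_in_map eq_oe; apply/eqP/ffunP => a.
by apply: eq_oe; rewrite -[a]rev_ordK map_f ?mem_index_enum.
Qed.

Lemma vpow_row o e : \sum_f vpow v o f * (vpow v e f)^* = (o == e)%:R.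
Proof.
rewrite /vpow; under eq_bigr do rewrite rmorph_prod -big_split.
rewrite -(bigA_distr_bigA (fun a k => v (o a) k * (v (e a) k)^*)) /=.
have rowE a : \sum_k v (o a) k * (v (e a) k)^* = (o a == e a)%:R.
  have /unitarymxP /matrixP /(_ (o a) (e a)) := v_unitary; rewrite !mxE => <-.
  by apply: eq_bigr => k _; rewrite !mxE.
under eq_bigr do rewrite rowE.
have [->|] := eqVneq o e; first by rewrite big1 // => a _; rewrite eqxx.
case/eqP/ffunP/existsNP => a /eqP/negPf oea.
by rewrite (bigD1 a) //= oea mul0r.
Qed.

Lemma vpow_col o e : \sum_f (vpow v f o)^* * vpow v f e = (o == e)%:R.
Proof.
rewrite /vpow; under eq_bigr do rewrite rmorph_prod -big_split.
rewrite -(bigA_distr_bigA (fun a k => (v k (o a))^* * v k (e a))) /=.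
have colE a : \sum_k (v k (o a))^* * v k (e a) = (o a == e a)%:R.
  have /unitarymxP/mulmx1C /matrixP /(_ (o a) (e a)) := v_unitary.
  rewrite !mxE => <-.
  by apply: eq_bigr => k _; rewrite !mxE.
under eq_bigr do rewrite colE.
have [->|] := eqVneq o e; first by rewrite big1 // => a _; rewrite eqxx.
case/eqP/ffunP/existsNP => a /eqP/negPf oea.
by rewrite (bigD1 a) //= oea mul0r.
Qed.

Lemma vpow_neq0 o e : vpow v o e != 0.
Proof. by apply/prodf_neq0 => a _; exact: v_neq0. Qed.

Definition qpair o e : qudit_pairs d z := [ffun a => (o a, e a)].

Lemma ket_qpair o e : ket_part (qpair o e) = o.
Proof. by apply/ffunP => a; rewrite !ffunE. Qed.

Lemma bra_qpair o e : bra_part (qpair o e) = e.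
Proof. by apply/ffunP => a; rewrite !ffunE. Qed.

Lemma qpairK (c : qudit_pairs d z) : qpair (ket_part c) (bra_part c) = c.
Proof. by apply/ffunP => a; rewrite !ffunE -surjective_pairing. Qed.

Lemma sum_qpair (F : qudit_pairs d z -> C) :
  \sum_c F c = \sum_o \sum_e F (qpair o e).
Proof.
rewrite pair_bigA.
rewrite (reindex (fun p : qudits d z * qudits d z => qpair p.1 p.2)) //=.
exists (fun c => (ket_part c, bra_part c)) => [[p q]|c] _ /=.
  by rewrite ket_qpair bra_qpair.
by rewrite qpairK.
Qed.

Definition vpow_pair : 'M[C]_#|qudit_pairs d z| := fmx (fun r c =>
  vpow v (ket_part r) (ket_part c) * (vpow v (bra_part r) (bra_part c))^*).

Definition overlap_row : 'rV[C]_#|qudit_pairs d z| :=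
  \row_r overlap u (ket_part (enum_val r)) (bra_part (enum_val r)).

Lemma transferL_factor : T = diag_mx overlap_row *m vpow_pair.
Proof.
apply/matrixP => r c; rewrite mul_diag_mx.
have := transferL_entry u v (enum_val r) (enum_val c).
by rewrite /entry !enum_valK => TE; rewrite [LHS]TE !mxE.
Qed.

Lemma vpow_pairE o o' (x : 'cV[C]_#|qudit_pairs d z|) :
  (vpow_pair *m x) (enum_rank (qpair o o')) 0 =
  \sum_e \sum_e' vpow v o e * (vpow v o' e')^* * x (enum_rank (qpair e e')) 0.
Proof.
rewrite mxE sum_ord_enum sum_qpair.
apply: eq_bigr => e _; apply: eq_bigr => e' _.
by rewrite mxE !enum_rankK !ket_qpair !bra_qpair.
Qed.

Lemma vpow_pair_unitary : vpow_pair \is unitarymx.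
Proof.
apply/unitarymxP/matrixP => r r'; rewrite -[r]enum_valK -[r']enum_valK.
rewrite -[enum_val r]qpairK -[enum_val r']qpairK.
move: (ket_part _) (bra_part _) (ket_part _) (bra_part _) => p p' q q'.
rewrite mxE sum_ord_enum sum_qpair [RHS]mxE (inj_eq enum_rank_inj).
transitivity ((\sum_e vpow v q e * (vpow v p e)^*) *
              (\sum_e (vpow v q' e * (vpow v p' e)^*)^*)).
  rewrite mulr_suml; apply: eq_bigr => e _.
  rewrite mulr_sumr; apply: eq_bigr => e' _.
  rewrite !mxE !enum_rankK !ket_qpair !bra_qpair !rmorphM /= conjCK.
  by ring.
rewrite -rmorph_sum /= !vpow_row rmorph_nat -natrM mulnb; congr (_ : bool)%:R.
apply/andP/eqP => [ [/eqP -> /eqP ->] // |eq_pair].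
by split; apply/eqP; [rewrite -[q](ket_qpair _ q') eq_pair ket_qpair |
  rewrite -[q'](bra_qpair q) eq_pair bra_qpair].
Qed.

Lemma circE o e : circ (enum_rank (qpair o e)) 0 = (o == e)%:R.
Proof.
rewrite /circ /tens_pow mxE enum_rankK.
under eq_bigr do rewrite mxE enum_rankK ffunE /=.
have [->|] := eqVneq o e; first by rewrite big1 // => a _; rewrite eqxx.
case/eqP/ffunP/existsNP => a /eqP/negPf oea.
by rewrite (bigD1 a) //= oea mul0r.
Qed.

Lemma circ_adjE o e : (circ^t*) 0 (enum_rank (qpair o e)) = (o == e)%:R.
Proof. by rewrite -[RHS](rmorph_nat (@Num.conj C)) -circE !mxE. Qed.

Lemma col_qpairP (x y : 'cV[C]_#|qudit_pairs d z|) :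
    (forall o e, x (enum_rank (qpair o e)) 0 = y (enum_rank (qpair o e)) 0) ->
  x = y.
Proof.
move=> xy; apply/matrixP => r k; rewrite ord1 -[r]enum_valK -[enum_val r]qpairK.
exact: xy.
Qed.

Lemma transferL_col (x : 'cV[C]_#|qudit_pairs d z|) o e :
  (T *m x) (enum_rank (qpair o e)) 0 =
  overlap u o e * (vpow_pair *m x) (enum_rank (qpair o e)) 0.
Proof.
by rewrite transferL_factor -mulmxA mul_diag_mx !mxE enum_rankK ket_qpair
  bra_qpair.
Qed.

(** Conjugation by the unitary v^{(x) z} fixes the identity operator, which lives on labels with
    equal ket and bra, where the overlap is [d]. On the left side, [circ_transferL] is invariance of
    the trace. *)
Lemma transferL_circ : T *m circ = d%:R *: circ.
Proof.
apply: col_qpairP => o o'; rewrite transferL_col vpow_pairE [RHS]mxE circE.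
under eq_bigr => e _.
  rewrite (bigD1 e) //= big1 ?addr0 => [|e' /negPf e'e]; last first.
    by rewrite circE eq_sym e'e mulr0.
  rewrite circE eqxx mulr1.
  over.
rewrite vpow_row; have [->|] := eqVneq o o'; first by rewrite overlap_diag.
by rewrite !mulr0.
Qed.

Lemma circ_transferL : circ^t* *m T = d%:R *: circ^t*.
Proof.
apply/matrixP => k c; rewrite ord1 -[c]enum_valK -[enum_val c]qpairK.
move: (ket_part _) (bra_part _) => l m.
rewrite [RHS]mxE circ_adjE mxE sum_ord_enum sum_qpair.
rewrite [l == m]eq_sym -(vpow_col m l) mulr_sumr; apply: eq_bigr => o _.
rewrite (bigD1 o) //= big1 ?addr0 => [|o' /negPf o'o]; last first.
  by rewrite circ_adjE eq_sym o'o mul0r.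
rewrite circ_adjE eqxx mul1r.
have := transferL_entry u v (qpair o o) (qpair l m); rewrite /entry => ->.
by rewrite !ket_qpair !bra_qpair overlap_diag; congr (_ * _); rewrite mulrC.
Qed.

(** Off the diagonal [vpow_pair *m x] vanishes by the support lemma, hence so does [x]. Writing [f]
    for the resulting diagonal operator and w for v^{(x) z}, the eigenvalue equation is d w f
    w^dagger = l f, that is d w f = l f w; the entry of w at (o, m) is nonzero and cancels. *)
Lemma extremal_eigenvector (l : C) (x : 'cV[C]_#|qudit_pairs d z|) :
  d%:R <= `|l| -> T *m x = l *: x ->
  let f o := x (enum_rank (qpair o o)) 0 in
  (forall o e, o != e -> x (enum_rank (qpair o e)) 0 = 0) /\
  (forall o m, d%:R * f m = l * f o).
Proof.
move=> dl eigx f.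
have dC : 0 < d%:R :> C by rewrite ltr0n.
have l0 : l != 0 by rewrite -normr_gt0 (lt_le_trans dC).
have Vx0 o e : o != e -> (vpow_pair *m x) (enum_rank (qpair o e)) 0 = 0.
  move=> oe; have dl0 : 0 <= (d%:R : C) <= `|l| by rewrite (ltW dC).
  have overlap_le r : `|overlap_row 0 r| <= d%:R.
    rewrite mxE; move: (ket_part _) (bra_part _) => a b.
    have [->|/overlap_lt/ltW//] := eqVneq a b.
    by rewrite overlap_diag normr_nat.
  move: eigx; rewrite transferL_factor => eigx.
  apply: (extremal_eigenvector_support vpow_pair_unitary dl0 overlap_le eigx).
  by rewrite mxE enum_rankK ket_qpair bra_qpair overlap_lt.
have eigE o e : overlap u o e * (vpow_pair *m x) (enum_rank (qpair o e)) 0 =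
    l * x (enum_rank (qpair o e)) 0.
  by rewrite -transferL_col eigx mxE.
have x0 o e : o != e -> x (enum_rank (qpair o e)) 0 = 0.
  move=> oe; have /eqP := eigE o e.
  rewrite Vx0 // mulr0 eq_sym mulf_eq0 (negPf l0).
  by move=> /eqP.
split=> // o m.
have VxE o' : d%:R * \sum_e vpow v o e * (vpow v o' e)^* * f e =
    l * (o == o')%:R * f o.
  have -> : \sum_e vpow v o e * (vpow v o' e)^* * f e =
      (vpow_pair *m x) (enum_rank (qpair o o')) 0.
    rewrite vpow_pairE; apply: eq_bigr => e _; rewrite [RHS](bigD1 e) //=.
    by rewrite big1 ?addr0 // => e' e'e; rewrite x0 ?mulr0 // eq_sym.
  have [<-|/Vx0 ->] := eqVneq o o'; last by rewrite !mulr0 mul0r.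
  by rewrite -(overlap_diag o) eigE mulr1.
(* Multiplying [VxE] on the right by v^{(x) z} and using orthonormality of its columns isolates the
   entry at [o], [m]. *)
apply: (mulIf (vpow_neq0 o m)).
transitivity (\sum_o'
    (d%:R * \sum_e vpow v o e * (vpow v o' e)^* * f e) * vpow v o' m).
  under [RHS]eq_bigr do rewrite -mulrA mulr_suml.
  rewrite -mulr_sumr exchange_big /= -mulrA; congr (_ * _).
  transitivity (\sum_e (vpow v o e * f e) *
      \sum_o' (vpow v o' e)^* * vpow v o' m).
    under eq_bigr do rewrite vpow_col.
    rewrite (bigD1 m) //= eqxx mulr1 big1 ?addr0 1?mulrC // => e /negPf ->.
    by rewrite mulr0.
  apply: eq_bigr => e _; rewrite mulr_sumr; apply: eq_bigr => o' _.
  by ring.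
under eq_bigr do rewrite VxE.
rewrite (bigD1 o) //= eqxx mulr1 big1 ?addr0 // => o' /negPf.
by rewrite eq_sym => ->; rewrite mulr0 !mul0r.
Qed.

Lemma transferL_right (x : 'cV[C]_#|qudit_pairs d z|) :
  T *m x = d%:R *: x -> exists c, x = c *: circ.
Proof.
have dC : d%:R != 0 :> C by rewrite pnatr_eq0 -lt0n.
move=> /extremal_eigenvector []; first by rewrite normr_nat.
move=> x0 fE; pose o0 : qudits d z := [ffun => Ordinal d_gt0].
exists (x (enum_rank (qpair o0 o0)) 0); apply: col_qpairP => o e.
rewrite mxE circE; have [<-|/x0 ->] := eqVneq o e; last by rewrite mulr0.
by rewrite mulr1; apply: (mulfI dC); exact: fE.
Qed.

Lemma transferL_spectrum :
  [/\ mup d%:R (char_poly T) = 1%N,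
      forall l, eigenvalue T l -> l != d%:R -> `|l| < d%:R,
      forall x, T *m x = d%:R *: x <-> exists c, x = c *: circ &
      forall y, y *m T = d%:R *: y <-> exists c, y = c *: circ^t*].
Proof.
have dC : d%:R != 0 :> C by rewrite pnatr_eq0 -lt0n.
pose o0 : qudits d z := [ffun => Ordinal d_gt0].
have circ_norm : (circ^t* *m circ) 0 0 != 0.
  rewrite mxE psumr_neq0 => [|r _]; last first.
    by rewrite [(circ^t*) _ _]mxE [X in X^*]mxE mulrC mul_conjC_ge0.
  apply/hasP; exists (enum_rank (qpair o0 o0)); rewrite ?mem_index_enum //=.
  by rewrite circ_adjE circE eqxx mulr1 ltr01.
have circ0 : circ^t* != 0.
  by apply: contraNneq circ_norm => ->; rewrite mul0mx mxE.
have left := left_eigenline circ0 circ_transferL transferL_right.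
split.
- exact: mup_simple_eigenvalue dC transferL_circ circ_transferL circ_norm left.
- move=> l /eigenvalue_col [x x_neq0 eigx]; apply: contraNT.
  rewrite real_ltNge ?realE ?normr_ge0 ?ler0n // negbK => dl.
  have [x0 fE] := extremal_eigenvector dl eigx.
  (* A nonzero diagonal [x] has a nonzero entry at some [p], and the relation at (p, p) then says
     that [l] equals [d]. *)
  have [p fp] : exists p, x (enum_rank (qpair p p)) 0 != 0.
    apply: contrapT => /forallNP f0; case/eqP: x_neq0; apply: col_qpairP => o e.
    rewrite [RHS]mxE; have [<-|/x0 // ] := eqVneq o e.
    by apply/eqP; have /negP := f0 o; rewrite negbK.
  by rewrite -(inj_eq (mulIf fp)) (fE p p).
- move=> x; split=> [/transferL_right // |[c ->]].
  by rewrite -scalemxAr transferL_circ scalerA mulrC -scalerA.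
- move=> y; split=> [/left // |[c ->]].
  by rewrite -scalemxAl circ_transferL scalerA mulrC -scalerA.
Qed.

End TransferSpectrum.

(** * Haar genericity *)

Section FinitelyManyTranslates.
Context d (T : measurableType d) (R : realType) (P : probability T R).

(** The limsup of the events is null by hypothesis, while by continuity from above its probability
    is the limit of those of the tail unions, each at least [p]. *)
Lemma null_of_finitely_many (B : (set T)^nat) (p : \bar R) :
  (forall n, measurable (B n)) -> (forall n, P (B n) = p) ->
  {ae P, forall w, exists n0, forall n, (n0 <= n)%N -> ~ B n w} -> p = 0%E.
Proof.
move=> mB PB aeB.
have lim0 : P (lim_sup_set B) = 0%E.
  have [N [mN N0 subN]] := aeB.
  apply: (subset_measure0 _ _ _ N0) => //.
    by apply: bigcap_measurable => // n _; apply: bigcup_measurable.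
  move=> w Bw; apply: subN => /= -[n0 nB].
  by have [n /= n0n Bn] := Bw n0 I; exact: (nB n).
apply/eqP; rewrite eq_le; apply/andP; split; last by rewrite -(PB 0%N).
have fin : (P (\bigcup_(k >= 0) B k) < +oo)%E.
  rewrite (le_lt_trans (probability_le1 _ _)) ?ltry//.
  exact: bigcup_measurable.
have cvgB := lim_sup_set_cvg P B mB fin.
rewrite -lim0 -(cvg_lim _ cvgB)//; apply: lime_ge.
  by apply/cvg_ex; eexists; exact: cvgB.
apply: nearW => n; rewrite -(PB n); apply: le_measure; rewrite ?inE//.
  exact: bigcup_measurable.
by move=> w Bw; exists n => /=.
Qed.

Lemma probability0_ae (A : set T) : measurable A -> P A = 0%E ->
  {ae P, forall w, ~ A w}.
Proof. by move=> mA A0; exists A; split=> // w /=; rewrite not_notE. Qed.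

Lemma probability1_ae (A : set T) : measurable A -> P A = 1%E ->
  {ae P, forall w, A w}.
Proof.
move=> mA A1; exists (~` A); split=> //; first exact: measurableC.
by rewrite probability_setC// A1 subee.
Qed.

End FinitelyManyTranslates.

(** * Measurability of complex functions through real and imaginary parts *)

Section MeasurableComplex.
Context (R : realType) d (T : measurableType d).
Implicit Types f g : T -> R[i].

Definition cmeas f := measurable_fun setT (@complex.Re R \o f) /\
  measurable_fun setT (@complex.Im R \o f).

Lemma cmeas_cst c : cmeas (fun=> c).
Proof. by split; exact: measurable_cst. Qed.

Lemma cmeasD f g : cmeas f -> cmeas g -> cmeas (fun x => f x + g x).
Proof.
move=> [f1 f2] [g1 g2]; split.
  rewrite (_ : _ \o _ = (@complex.Re R \o f) \+ (@complex.Re R \o g)).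
    exact: measurable_funD.
  by apply/funext => x /=; case: (f x) (g x) => ? ? [].
rewrite (_ : _ \o _ = (@complex.Im R \o f) \+ (@complex.Im R \o g)).
  exact: measurable_funD.
by apply/funext => x /=; case: (f x) (g x) => ? ? [].
Qed.

Lemma cmeasM f g : cmeas f -> cmeas g -> cmeas (fun x => f x * g x).
Proof.
move=> [f1 f2] [g1 g2]; split.
  rewrite (_ : _ \o _ =
    ((@complex.Re R \o f) \* (@complex.Re R \o g)) \-
    ((@complex.Im R \o f) \* (@complex.Im R \o g))).
    by apply: measurable_funB; exact: measurable_funM.
  by apply/funext => x /=; case: (f x) (g x) => ? ? [].
rewrite (_ : _ \o _ =
    ((@complex.Re R \o f) \* (@complex.Im R \o g)) \+
    ((@complex.Im R \o f) \* (@complex.Re R \o g))).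
  by apply: measurable_funD; exact: measurable_funM.
by apply/funext => x /=; case: (f x) (g x) => ? ? [].
Qed.

Lemma cmeas_conj f : cmeas f -> cmeas (fun x => (f x)^*).
Proof.
move=> [f1 f2]; split.
  rewrite (_ : _ \o _ = (@complex.Re R \o f))//.
  by apply/funext => x /=; case: (f x).
rewrite (_ : _ \o _ = \- (@complex.Im R \o f)); first exact: measurable_funN.
by apply/funext => x /=; case: (f x).
Qed.

Lemma cmeas_sum (I : Type) (r : seq I) (F : I -> T -> R[i]) :
  (forall i, cmeas (F i)) -> cmeas (fun x => \sum_(i <- r) F i x).
Proof.
move=> mF; elim: r => [|i r IHr].
  by under eq_fun do rewrite big_nil; exact: cmeas_cst.
by under eq_fun do rewrite big_cons; exact: cmeasD.
Qed.

Lemma cmeas_eq0 f : cmeas f -> measurable [set x | f x = 0].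
Proof.
move=> [f1 f2]; rewrite (_ : mkset _ =
  ((@complex.Re R \o f) @^-1` [set 0]) `&`
  ((@complex.Im R \o f) @^-1` [set 0])).
  apply: measurableI; rewrite -[X in measurable X]setTI; [exact: f1|].
  exact: f2.
apply/seteqP; split=> x /=; first by move=> ->.
by case: (f x) => a b /= [-> ->].
Qed.

End MeasurableComplex.

(** * Borel structure on matrices: translations and entries *)

Section MatrixBorel.
Context (R : realType) (n : nat).

Lemma mxborel_open (A : set 'M[R[i]^o]_n) : open A ->
  measurable (A : set (mxborel R n)).
Proof. exact: sub_sigma_algebra. Qed.

Lemma mulmx_continuous (g : 'M[R[i]^o]_n) :
  continuous (fun h : 'M[R[i]^o]_n => (g *m h) : 'M[R[i]^o]_n).
Proof.
move=> h; have nbhs_h := nbhs_filter (h : 'M[R[i]^o]_n).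
apply/(@cvg_ballP _ _ _ _ nbhs_h) => e e0.
have cvg_entry i j : (g *m h') i j @[h' --> h] --> ((g *m h) i j : R[i]^o).
  have cvg_sum (r : seq 'I_n) : \sum_(k <- r) g i k * (h' : 'M[R[i]^o]_n) k j
      @[h' --> h] --> (\sum_(k <- r) g i k * h k j : R[i]^o).
    elim: r => [|k r IHr].
      by under eq_fun do rewrite big_nil; rewrite big_nil; exact: cvg_cst.
    under eq_fun do rewrite big_cons; rewrite big_cons.
    apply: cvgD IHr; apply: cvgM; first exact: cvg_cst.
    exact: coord_continuous.
  by rewrite mxE; under eq_fun do rewrite mxE; exact: cvg_sum.
near=> h'; split=> //; near: h'.
apply: (@filter_forall _ _ _ _ nbhs_h) => i.
apply: (@filter_forall _ _ _ _ nbhs_h) => j.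
exact: (cvg_ball (cvg_entry i j)).
Unshelve. all: by end_near. Qed.

Lemma measurable_mulmx (g : 'M[R[i]]_n) :
  measurable_fun setT (fun h : mxborel R n => (g *m h) : mxborel R n).
Proof.
apply: (@measurability _ _ (mxborel R n) (mxborel R n) setT _
  (@open 'M[R[i]^o]_n)) => //.
move=> _ [A oA <-]; rewrite setTI; apply: mxborel_open.
by have /continuousP := @mulmx_continuous g; exact.
Qed.

(** Meant for [f] the real or imaginary part, both additive and 1-Lipschitz. *)
Lemma entry_continuous (f : R[i] -> R) (i j : 'I_n) :
    {morph f : x y / x - y} -> (forall x, `|f x|%:C%C <= `|x|) ->
  continuous (f \o (fun h : 'M[R[i]^o]_n => h i j)).
Proof.
move=> fB fle h; have nbhs_h := nbhs_filter (h : 'M[R[i]^o]_n).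
apply/(@cvgrPdist_lt _ _ _ _ nbhs_h) => e e0; near=> h'; rewrite /= -fB -ltcR.
apply: (le_lt_trans (fle _)); near: h'.
have /cvgrPdist_lt : (M i j @[M --> (h : 'M[R[i]^o]_n)]) --> h i j.
  exact: coord_continuous.
by move=> /(_ e%:C%C); apply; rewrite ltcR.
Unshelve. all: by end_near. Qed.

Lemma cmeas_entry (i j : 'I_n) :
  cmeas (fun h : mxborel R n => (h : 'M[R[i]]_n) i j).
Proof.
have key (f : R[i] -> R) : {morph f : x y / x - y} ->
    (forall x, `|f x|%:C%C <= `|x|) ->
    measurable_fun setT (f \o (fun h : mxborel R n => (h : 'M[R[i]]_n) i j)).
  move=> fB fle; apply: (measurability _ (RGenOpens.measurableE R)).
  move=> _ [_ [a [b ->] <-]]; rewrite setTI; apply: mxborel_open.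
  have /continuousP cf := @entry_continuous f i j fB fle.
  by apply: cf; exact: interval_open.
split; apply: key.
- by case=> ? ? [].
- exact: normc_ge_Re.
- by case=> ? ? [].
(* Up to sign the imaginary part of x is the real part of x i, which has the same modulus bound. *)
- move=> x; have := normc_ge_Re (x * 'i%C).
  by rewrite ReiNIm normrN normrM complexiE normCi mulr1.
Qed.

End MatrixBorel.

(** * Joint law of an independent family *)

Section ProductSigmaAlgebra.
Context (R : realType) (d d' : measure_display) (T : measurableType d)
  (P : probability T R).
Context (T' : measurableType d') (I : finType).
Implicit Types X Y : I -> {RV P >-> T'}.

Definition rectangles : set (set (I -> T')) :=
  [set B | exists2 A : I -> set T', (forall i, measurable (A i)) &
     B = [set f | forall i, A i (f i)]].

Definition family := g_sigma_algebraType rectangles.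

Lemma measurable_proj (i : I) : measurable_fun setT (fun f : family => f i).
Proof.
move=> _ A mA; rewrite setTI; apply: sub_sigma_algebra.
exists (fun k => if k == i then A else setT) => [k|].
  by case: (k == i).
apply/seteqP; split=> f /= => [Af k|/(_ i)]; last by rewrite eqxx.
by case: eqP => // ->.
Qed.

Definition joint X (w : T) : family := fun i => X i w.

Lemma joint_preimage X (A : I -> set T') :
  joint X @^-1` [set f | forall i, A i (f i)] =
  \bigcap_(i in [set i | i \in [set: I]%SET]) (X i @^-1` A i).
Proof.
apply/seteqP; split=> w /= Xw i; first by move=> _; exact: Xw.
by apply: Xw; rewrite /= inE.
Qed.

Lemma measurable_joint X : measurable_fun setT (joint X).
Proof.
apply: (@measurability _ _ T family setT _ rectangles) => //.
move=> _ [_ [A mA ->] <-]; rewrite setTI joint_preimage.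
apply: fin_bigcap_measurable => //.
move=> i _; rewrite -[X in measurable X]setTI.
exact: measurable_funP.
Qed.

HB.instance Definition _ X :=
  isMeasurableFun.Build _ _ _ _ (joint X) (measurable_joint X).

(** Independence and equal marginals give agreement on rectangles, which are closed under
    intersection and generate the product sigma-algebra; uniqueness of measures does the rest. *)
Lemma eq_joint_distribution X Y (B : set family) :
  mutually_independent X -> mutually_independent Y ->
  (forall i A, measurable A -> P (X i @^-1` A) = P (Y i @^-1` A)) ->
  measurable B -> P (joint X @^-1` B) = P (joint Y @^-1` B).
Proof.
move=> indX indY eqXY mB.
apply: (@g_sigma_algebra_measure_unique _ R family rectangles _ (fun=> setT)
  _ _ (distribution P (joint X)) (distribution P (joint Y))) => //.
- by move=> A; exact: sub_sigma_algebra.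
- move=> _; exists (fun=> setT) => //; apply/seteqP; split=> //.
- by apply/seteqP; split=> // x _; exists 0%N.
- move=> _ _ [A mA ->] [A' mA' ->]; exists (fun i => A i `&` A' i).
    by move=> i; exact: measurableI.
  apply/seteqP; split=> f /= => [[Af A'f] i|AA'f]; first by split.
  by split=> i; have [] := AA'f i.
- move=> _ [A mA ->]; rewrite [LHS](congr1 P (joint_preimage X A)).
  rewrite [RHS](congr1 P (joint_preimage Y A)).
  by rewrite indX// indY//; apply: eq_bigr => i _; exact: eqXY.
- by move=> _; rewrite (le_lt_trans (probability_le1 _ _)) ?ltry.
Qed.

End ProductSigmaAlgebra.

(** * Generic properties of Haar unitaries *)

Section HaarGenericity.
Variables (R : realType) (d : nat) (disp : measure_display).
Variables (Omega : measurableType disp) (P : probability Omega R).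
Implicit Types (Y : {RV P >-> mxborel R d}) (g : 'M[R[i]]_d).

Definition translate g Y (w : Omega) : mxborel R d := g *m (Y w : 'M[R[i]]_d).

Lemma measurable_translate g Y : measurable_fun setT (translate g Y).
Proof.
by apply: (measurableT_comp (measurable_mulmx g)); exact: measurable_funP.
Qed.

HB.instance Definition _ g Y :=
  isMeasurableFun.Build _ _ _ _ (translate g Y) (measurable_translate g Y).

Lemma haar_translate g Y (A : set (mxborel R d)) :
  is_haar (distribution P Y) -> g \is unitarymx -> measurable A ->
  P (translate g Y @^-1` A) = P (Y @^-1` A).
Proof. by move=> [_ inv] gU mA; exact: inv. Qed.

Lemma measurable_unitary :
  measurable [set g : mxborel R d | (g : 'M[R[i]]_d) \is unitarymx].
Proof.
pose defect (p : 'I_d * 'I_d) (g : mxborel R d) : R[i] :=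
  \sum_k (g : 'M[R[i]]_d) p.1 k * ((g : 'M[R[i]]_d) p.2 k)^* +
  - (p.1 == p.2)%:R.
have -> : [set g : mxborel R d | (g : 'M[R[i]]_d) \is unitarymx] =
    \bigcap_(p in setT) [set g | defect p g = 0].
  apply/seteqP; split=> g /=.
    move=> /unitarymxP gU p _; apply/eqP; rewrite subr_eq0; apply/eqP.
    have /matrixP /(_ p.1 p.2) := gU; rewrite !mxE => <-.
    by apply: eq_bigr => k _; rewrite !mxE.
  move=> g0; apply/unitarymxP/matrixP => i j; rewrite !mxE; apply/eqP.
  rewrite -subr_eq0 -[X in _ == X](g0 (i, j) I) /defect.
  apply/eqP; congr (_ + _).
  by apply: eq_bigr => k _; rewrite !mxE.
apply: fin_bigcap_measurable => // p _; apply: cmeas_eq0.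
apply: cmeasD; last exact: cmeas_cst.
apply: cmeas_sum => k; apply: cmeasM; first exact: cmeas_entry.
by apply: cmeas_conj; exact: cmeas_entry.
Qed.

Lemma haar_unitary_ae Y : is_haar (distribution P Y) ->
  {ae P, forall w, (Y w : 'M[R[i]]_d) \is unitarymx}.
Proof.
move=> [Y1 _].
have mU : measurable (Y @^-1`
    [set g : mxborel R d | (g : 'M[R[i]]_d) \is unitarymx]).
  rewrite -[X in measurable X]setTI.
  by apply: measurable_funP => //; exact: measurable_unitary.
exact: (probability1_ae mU Y1).
Qed.

Lemma haar_entry_neq0_ae Y : is_haar (distribution P Y) ->
  {ae P, forall w, forall i j, (Y w : 'M[R[i]]_d) i j != 0}.
Proof.
move=> haarY; apply: filter_forall => i; apply: filter_forall => j.
have [s s_inj s1] := injective_unimodular (R[i] : numClosedFieldType).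
pose A := [set h : mxborel R d | (h : 'M[R[i]]_d) i j = 0].
have mA : measurable A by apply: cmeas_eq0; exact: cmeas_entry.
have mpre (Z : {RV P >-> mxborel R d}) : measurable (Z @^-1` A).
  by rewrite -[X in measurable X]setTI; exact: measurable_funP.
have pA : P (Y @^-1` A) = 0%E.
  apply: (@null_of_finitely_many _ _ _ P
    (fun n => translate (entry_mover d (s n)) Y @^-1` A)).
  - by move=> n; exact: mpre.
  - by move=> n; apply: haar_translate => //; exact: entry_mover_unitary.
  - apply: filterS (haar_unitary_ae haarY) => w YU.
    have [p p0 pE] := entry_mover_poly i j YU.
    have [n0 n0P] := eventually_not_root p0 s_inj.
    by exists n0 => n /n0P; rewrite -pE => /eqP.
by apply: filterS (probability0_ae (mpre Y) pA) => w /= /eqP.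
Qed.

Variable u : 'I_d -> {RV P >-> mxborel R d}.
Hypothesis u_haar : forall a, is_haar (distribution P (u a)).
Hypothesis u_indep : mutually_independent u.

Lemma translate_indep (g : 'I_d -> 'M[R[i]]_d) :
  mutually_independent
    (fun a => translate (g a) (u a) : {RV P >-> mxborel R d}).
Proof.
move=> J A mA.
pose A' a := (fun h : mxborel R d => g a *m h : mxborel R d) @^-1` A a.
apply: (u_indep J (A := A')) => a; rewrite -[A' a]setTI.
exact: measurable_mulmx.
Qed.

Lemma cmeas_word (t : seq 'I_d) (i j : 'I_d) :
  cmeas (fun f : family (mxborel R d) 'I_d =>
    word (f : 'I_d -> 'M[R[i]]_d) t i j).
Proof.
elim: t i j => [|x t IHt] i j /=; first exact: cmeas_cst.
rewrite (_ : (fun _ => _) = fun f : family (mxborel R d) 'I_d =>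
    \sum_k (f x : 'M[R[i]]_d) i k * word (f : 'I_d -> 'M[R[i]]_d) t k j);
  last by apply/funext => f; rewrite mxE.
apply: cmeas_sum => k; apply: cmeasM => //.
have [re im] := cmeas_entry R i k.
split; [exact: (measurableT_comp re (measurable_proj x))
       |exact: (measurableT_comp im (measurable_proj x))].
Qed.

(** All letters are translated at once, each by its own mover, so the invariance needed is that of
    the joint law. The nonvanishing of the minor as a polynomial uses that almost surely no letter
    has a zero entry. *)
Lemma first_letter_minor_neq0_ae (x y : 'I_d) (t t' : seq 'I_d) : x != y ->
  {ae P, forall w,
    first_letter_minor (fun a => u a w : 'M[R[i]]_d) x y t t' != 0}.
Proof.
move=> xy.
have [s s_inj s1] := injective_unimodular (R[i] : numClosedFieldType).
pose Q (f : family (mxborel R d) 'I_d) : R[i] :=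
  first_letter_minor (f : 'I_d -> 'M[R[i]]_d) x y t t'.
pose A := [set f | Q f = 0].
have mA : measurable A.
  apply: cmeas_eq0; apply: cmeasD; first by apply: cmeasM; exact: cmeas_word.
  rewrite (_ : (fun _ => _) = fun f : family (mxborel R d) 'I_d =>
    -1 * (word (f : 'I_d -> 'M[R[i]]_d) (x :: t) y x *
          word (f : 'I_d -> 'M[R[i]]_d) (y :: t') x x)).
    by apply: cmeasM; [exact: cmeas_cst|apply: cmeasM; exact: cmeas_word].
  by apply/funext => f; rewrite mulN1r.
have mpre (Z : 'I_d -> {RV P >-> mxborel R d}) : measurable (joint Z @^-1` A).
  by rewrite -[X in measurable X]setTI; exact: measurable_joint.
have pA : P (joint u @^-1` A) = 0%E.
  pose moved n a : {RV P >-> mxborel R d} :=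
    translate (letter_mover a (s n)) (u a).
  apply: (@null_of_finitely_many _ _ _ P (fun n => joint (moved n) @^-1` A)).
  - by move=> n; exact: mpre.
  - move=> n; apply: eq_joint_distribution => //; first exact: translate_indep.
    by move=> a B mB; apply: haar_translate => //; exact: letter_mover_unitary.
  - have : {ae P, forall w, forall a i j, (u a w : 'M[R[i]]_d) i j != 0}.
      by apply: filter_forall => a; exact: haar_entry_neq0_ae.
    apply: filterS => w u0.
    have [p p0 pE] := first_letter_minor_poly u0 t t' xy.
    have [n0 n0P] := eventually_not_root p0 s_inj.
    by exists n0 => n /n0P; rewrite -pE => /eqP.
by apply: filterS (probability0_ae (mpre u) pA) => w /= /eqP.
Qed.

(** Pairs of words are countable, so the exceptional null sets can be united; [pickle] numbers them,
    and integers that code nothing get a trivial condition. *)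
Lemma minors_neq0_ae : {ae P, forall w, forall x y t t', x != y ->
  first_letter_minor (fun a => u a w : 'M[R[i]]_d) x y t t' != 0}.
Proof.
pose good (c : 'I_d * 'I_d * (seq 'I_d * seq 'I_d)) (w : Omega) :=
  c.1.1 != c.1.2 -> first_letter_minor (fun a => u a w : 'M[R[i]]_d)
    c.1.1 c.1.2 c.2.1 c.2.2 != 0.
have : {ae P, forall w, forall n, oapp (good ^~ w) True (unpickle n)}.
  apply/ae_foralln => n; case: (unpickle n) => [[[x y] [t t']]|] /=; last first.
    exact: nearW.
  rewrite /good /=; have [_|xy] := eqVneq x y; first exact: nearW.
  by apply: filterS (first_letter_minor_neq0_ae t t' xy) => w w0 _.
apply: filterS => w good_w x y t t' xy.
have := good_w (pickle ((x, y), (t, t'))).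
by rewrite pickleK /= /good /=; exact.
Qed.

End HaarGenericity.

Lemma independent_Some (R : realType) (disp disp' : measure_display)
    (Omega : measurableType disp) (T : measurableType disp')
    (P : probability Omega R) (I : finType)
    (v : {RV P >-> T}) (u : I -> {RV P >-> T}) :
  mutually_independent (oapp u v) -> mutually_independent u.
Proof.
(* The image of [J] under [Some] avoids [None], so the default [setT] there only has to be
   measurable. *)
move=> indep J A mA; pose A' := oapp A setT.
have := indep (Some @: J) A'; rewrite big_imset /=; last by move=> a b _ _ [].
rewrite (_ : \bigcap_(i in [set i | i \in (Some @: J)%SET]) _ =
             \bigcap_(i in [set i | i \in J]) (u i @^-1` A i)); last first.
  apply/seteqP; split=> w /= Aw.
    by move=> a aJ; apply: (Aw (Some a)) => /=; exact: imset_f.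
  by move=> _ /imsetP[a aJ ->]; exact: Aw.
by apply => -[a|] /=; [exact: mA|exact: measurableT].
Qed.

Theorem theorem1 (R : realType) (d z : nat) (hd : (2 <= d)%N) (hz : (1 <= z)%N)
    (disp : measure_display) (Omega : measurableType disp)
    (P : probability Omega R)
    (v : {RV P >-> mxborel R d}) (u : 'I_d -> {RV P >-> mxborel R d})
    (v_haar : is_haar (distribution P v))
    (u_haar : forall j, is_haar (distribution P (u j)))
    (indep : mutually_independent (oapp u v)) :
  {ae P, forall w,
    let T := transferL z (gate_SL (fun j => u j w : 'M[R[i]]_d)
                                  (v w : 'M[R[i]]_d)) in
    let circ := tens_pow z (ket_circ R[i] d) in
    [/\ mup d%:R (char_poly T) = 1%N,
        forall l : R[i], eigenvalue T l -> l != d%:R -> `|l| < d%:R,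
        forall x : 'cV[R[i]]_#|qudit_pairs d z|,
          T *m x = d%:R *: x <-> exists c : R[i], x = c *: circ &
        forall y : 'rV[R[i]]_#|qudit_pairs d z|,
          y *m T = d%:R *: y <-> exists c : R[i], y = c *: circ^t*]}.
Proof.
have u_unitary : {ae P, forall w, forall a, (u a w : 'M[R[i]]_d) \is unitarymx}.
  by apply: filter_forall => a; exact: haar_unitary_ae.
have minors := minors_neq0_ae u_haar (independent_Some indep).
have v_unitary := haar_unitary_ae v_haar.
have v_neq0 := haar_entry_neq0_ae v_haar.
near=> w; apply: transferL_spectrum.
- exact: leq_trans hd.
- near: w; exact: u_unitary.
- near: w; exact: v_unitary.
- near: w; exact: v_neq0.
- near: w; exact: minors.
Unshelve. all: by end_near. Qed.
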